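(* The threshold bias of the rainbow-spanning-tree game $\mathcal{RS}_n$ satisfies $$\left(\tfrac{\log(2)}{8}-o(1)\right)\frac{n^2}{\log(n)}\leq b_{\mathcal{RS}_n}\leq (1+o(1))\frac{n^2}{\log(n)}.$$
   Context: $\log$ is the natural logarithm and $o(1)$ denotes a quantity tending to $0$ as $n\to\infty$. A $(1:b)$ Maker-Breaker game on a finite board $X$ with a family of winning sets: Maker and Breaker alternately claim unclaimed elements of $X$, Maker $1$ per round and Breaker $b$ per round, until all are claimed; Maker wins if she claims all elements of some winning set, otherwise Breaker wins. The threshold bias is the unique integer $b_0$ such that Breaker wins the $(1:b)$ game iff $b\geq b_0$. The rainbow-spanning-tree game $\mathcal{RS}_n$ is played on the board $X=\bigcup_{i\in[n-1]}E(G_i)$, where $G_1,\dots,G_{n-1}$ are distinct copies of $K_n$ on the common vertex set $V=[n]$; Maker wins iff she claims a rainbow spanning tree, i.e., a spanning tree on $V$ containing exactly one edge of each $G_i$. *)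

(* Defs.v *)
From mathcomp Require Import all_boot.
Set Implicit Arguments. Unset Strict Implicit. Unset Printing Implicit Defensive.

Section MakerBreaker.
Variable T : finType.
Variable board : {set T}.
Variable winning : pred {set T}.

Definition maker_has_won (M : {set T}) : bool :=
  [exists W : {set T}, winning W && (W \subset M)].

(* mw b k M Bk: with fuel k, Maker (to move) having claimed M and Breaker
   having claimed Bk, Maker can force a win in the (1:b) game.  Maker claims
   one free element per round, then Breaker claims b free elements (or all
   remaining ones if fewer than b are left); the game ends when every
   element of the board is claimed. *)
Fixpoint mw (b k : nat) (M Bk : {set T}) : bool :=
  let F := board :\: (M :|: Bk) in
  if F == set0 then maker_has_won M else
  match k with
  | 0 => false
  | k'.+1 =>
    [exists x in F,
       let M' := x |: M in
       let F' := F :\ x in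
       if F' == set0 then maker_has_won M' else
       [forall S : {set T},
          ((S \subset F') && (#|S| == minn b #|F'|)) ==> mw b k' M' (S :|: Bk)]]
  end.

(* Maker starts; fuel #|board|.+1 suffices as each round claims >= 1 element *)
Definition maker_wins (b : nat) : bool := mw b #|board|.+1 set0 set0.
Definition breaker_wins (b : nat) : bool := ~~ maker_wins b.

Definition is_threshold_bias (b0 : nat) : Prop :=
  forall b : nat, breaker_wins b <-> b0 <= b.
End MakerBreaker.

(* The rainbow spanning tree game RS_n.  An element (i, (u, v)) with u < v
   is the edge uv of the copy G_i of K_n, i : 'I_(n-1), on vertex set 'I_n. *)
Definition RS_elt (n : nat) : finType := ('I_n.-1 * ('I_n * 'I_n))%type.

Definition RS_board (n : nat) : {set RS_elt n} :=
  [set x : RS_elt n | (x.2.1 < x.2.2)%N].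

Definition adj (n : nat) (E : {set 'I_n * 'I_n}) : rel 'I_n :=
  fun u v => ((u, v) \in E) || ((v, u) \in E).

Definition spanning_tree (n : nat) (E : {set 'I_n * 'I_n}) : bool :=
  [forall e in E, (e.1 < e.2)%N] &&
  (#|E| == n.-1) && [forall u, forall v, connect (adj E) u v].

Definition is_rainbow_spanning_tree (n : nat) (S : {set RS_elt n}) : bool :=
  (S \subset RS_board n) &&
  [forall i : 'I_n.-1, #|[set x in S | x.1 == i]| == 1] &&
  spanning_tree [set x.2 | x in S].

(* Main.v *)
Require Import Defs.
From mathcomp Require Import all_boot all_order all_algebra.
From mathcomp Require Import zify lra.
Set Implicit Arguments. Unset Strict Implicit. Unset Printing Implicit Defensive.
Import Order.TTheory GRing.Theory Num.Theory.

(** Upper bound: Breaker tries to claim some [G_i] completely.  This is a box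
    game on [n - 1] disjoint boxes of size [n (n - 1) / 2]; spreading his moves
    evenly over the boxes that Maker has not touched, he has claimed about
    [b * H_(n-2)] elements of the last one when only one box is left.

    Lower bound: send the edge [uv] to the vector [e_u - e_v].  By Rado's
    theorem Maker owns a rainbow spanning tree if the edges that she has in any
    [j] colours have rank at least [j].  If this fails for [j] colours, consider
    the components of the graph of her edges in these colours.  If [j] is not
    too close to [n], choosing one vertex in each component gives a set of
    [n - j + 1] vertices with no such edge inside; otherwise some union [W] of
    components with [n - j <= |W| <= n / 2] is not left by any such edge.  Hence
    it suffices that Maker meets all the corresponding "barriers", and Beck's
    potential [sum over barriers A of 2 ^ (- |A| / b)] is initially below 1. *)

(** Pads a partial Breaker move to the exact number of elements that the rules prescribe, and trims
    sets to a given size. *)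
Lemma subset_of_card (T : finType) (A C : {set T}) (m : nat) :
  A \subset C -> #|A| <= m <= #|C| ->
  exists D : {set T}, [/\ A \subset D, D \subset C & #|D| = m].
Proof.
move=> sAC /andP[leAm lemC].
elim: m leAm lemC => [|m IHm] leAm lemC.
  exists A; split=> //; lia.
have [eqAm|ltAm] := eqVneq #|A| m.+1; first by exists A; split.
have [||D [sAD sDC cD]] := IHm; [lia|lia|].
have /properP[_ [x xC xD]] : D \proper C by rewrite properEcard sDC cD.
exists (x |: D); split; last by rewrite cardsU1 xD cD.
  exact: subset_trans sAD (subsetUr _ _).
by rewrite subUset sub1set xC.
Qed.

(** * Maker-Breaker games: monotonicity and existence of the threshold bias *)

Section Game.
Variables (T : finType) (board : {set T}) (winning : pred {set T}).
Implicit Types (M B S : {set T}) (b k : nat).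
Local Notation free M B := (board :\: (M :|: B)).
Local Notation won := (maker_has_won winning).
Local Notation mw := (mw board winning).

Lemma wonS M M' : M \subset M' -> won M -> won M'.
Proof.
move=> sMM' /existsP[W /andP[wW sWM]].
by apply/existsP; exists W; rewrite wW (subset_trans sWM sMM').
Qed.

Lemma mw_over b k M B : free M B = set0 -> mw b k M B = won M.
Proof. by case: k => [|k] /= ->; rewrite eqxx. Qed.

(** The case where Maker takes the last free element needs no separate clause: the only reply is
    then [set0], and [mw] of a full position is [maker_has_won]. *)
Lemma mwSP b k M B : free M B != set0 ->
  reflect (exists2 x, x \in free M B & forall S, S \subset free M B :\ x ->
             #|S| = minn b #|free M B :\ x| -> mw b k (x |: M) (S :|: B))
          (mw b k.+1 M B).
Proof.
move=> F0; rewrite [mw _ _ _ _]/= (negPf F0).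
have overE x : x \in free M B -> free M B :\ x = set0 ->
    free (x |: M) B = set0.
  move=> _ <-; apply/setP=> y; rewrite !inE; case: (y == x) => //=.
apply: (iffP existsP) => [[x /andP[xF H]]|[x xF H]]; exists x => //.
  move=> S sSF cS; case: eqP H => [F'0|_] H.
    have S0 : S = set0 by apply/eqP; rewrite -subset0 -F'0.
    by rewrite S0 set0U mw_over // overE.
  by have := forallP H S; rewrite sSF cS eqxx.
rewrite xF /=; case: eqP => [F'0|_].
  have := H set0; rewrite F'0 cards0 minn0 sub0set set0U mw_over ?overE //.
  exact.
by apply/forallP=> S; apply/implyP=> /andP[sSF /eqP]; apply: H.
Qed.

Lemma free_move_card M B S x : x \in free M B ->
  #|free (x |: M) (S :|: B)| < #|free M B|.
Proof.
move=> xF; apply: proper_card; apply/properP; split.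
  by apply: setDS; apply: setUSS; apply: subsetUr.
by exists x => //; rewrite !inE eqxx.
Qed.

Lemma mw_won b k M B : #|free M B| <= k -> won M -> mw b k M B.
Proof.
elim: k M B => [|k IHk] M B lek wM.
  by rewrite mw_over //; apply/eqP; rewrite -cards_eq0 -leqn0.
have [F0|F0] := eqVneq (free M B) set0; first by rewrite mw_over.
have [x xF] := set0Pn _ F0.
apply/mwSP => //; exists x => // S _ _; apply: IHk; last first.
  exact: wonS (subsetUr _ _) wM.
by rewrite -ltnS; apply: leq_trans lek; apply: free_move_card.
Qed.

(** Follow the game along arbitrary legal replies: Maker only ever owns elements of [M] or elements
    outside [B]. Hence Breaker has won once he owns a set that meets every winning set. *)
Lemma mw_sound b k M B : mw b k M B ->
  exists2 W : {set T}, winning W & W \subset M :|: (board :\: B).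
Proof.
elim: k M B => [|k IHk] M B;
  have [F0|F0] := eqVneq (free M B) set0;
  try by rewrite mw_over // => /existsP[W /andP[wW sWM]]; exists W => //;
    apply: subset_trans sWM (subsetUl _ _).
  by rewrite /= (negPf F0).
case/mwSP=> // x xF H.
have [||S [_ sSF cS]] := @subset_of_card _ set0 (free M B :\ x)
    (minn b #|free M B :\ x|); first exact: sub0set.
  by rewrite cards0 geq_minr.
have [W wW sW] := IHk _ _ (H S sSF cS).
exists W => //; apply: subset_trans sW _; apply/subsetP => y.
move: xF; rewrite !inE negb_or => /andP[/andP[xM xB] xb].
case: (eqVneq y x) => [->|_] /=; first by rewrite xb xB orbT.
by case: (y \in M) => //=; rewrite negb_or => /andP[/andP[_ ->] ->].
Qed.

(* Maker follows her strategy for bias [b] in an imaginary position in which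
   she owns less and Breaker owns more than in the real one. *)
Lemma mw_mono b b' k k' M M' B B' :
  b' <= b -> M \subset M' -> B' \subset B -> #|free M' B'| <= k' ->
  mw b k M B -> mw b' k' M' B'.
Proof.
move=> leb; elim: k k' M M' B B' => [|k IHk] k' M M' B B' sM sB lek';
  have [F0|F0] := eqVneq (free M B) set0; try by
    rewrite [mw b _ _ _]mw_over // => wM; apply: mw_won lek' (wonS sM wM).
  by rewrite /= (negPf F0).
move=> Hmw; have [F'0|F'0] := eqVneq (free M' B') set0.
  (* The real board is full, so whatever lies outside [B], hence outside [B'], already belongs to
     [M']. *)
  rewrite mw_over //; have [W wW sW] := mw_sound Hmw.
  apply/existsP; exists W; rewrite wW; apply: subset_trans sW _.
  apply/subsetP=> y; move/setP/(_ y): F'0; rewrite !inE.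
  have := subsetP sM y; have := subsetP sB y.
  case: (y \in M') => //=; case: (y \in M) => [_ /(_ isT)|] //=.
  by case: (y \in B') => [/(_ isT) ->|] //=; rewrite ?andbT => _ _ ->; rewrite andbF.
case: k' lek' => [|k'] lek'.
  by move: F'0; rewrite -cards_eq0 -leqn0 lek'.
case/mwSP: Hmw => // x xF H.
(* If the imaginary move [x] is already owned in the real game, any free element [y] is claimed
   instead. *)
have [y yF xy] : exists2 y, y \in free M' B' & x \in y |: M'.
  have [xM'|xM'] := boolP (x \in M').
    by have [y yF] := set0Pn _ F'0; exists y => //; rewrite !inE xM' orbT.
  exists x; rewrite !inE ?eqxx //.
  move: xF; rewrite !inE !negb_or xM' => /andP[/andP[_ xB] ->].
  by rewrite andbT /=; apply: contra xB; apply: (subsetP sB).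
apply/mwSP => //; exists y => // S sSF cS.
have sM1 : x |: M \subset y |: M'.
  by rewrite subUset sub1set xy (subset_trans sM) ?subsetUr.
have sub : S :\: B \subset free M B :\ x.
  apply/subsetP=> z; rewrite inE => /andP[zB zS].
  have := subsetP sSF z zS; have := subsetP sM1 z; rewrite !inE !negb_or zB.
  case: (z \in M') => /=; first by rewrite !andbF.
  case: (z == y) => //=.
  case: (z == x) => //= [/(_ isT)|] //; case: (z \in M) => // [/(_ isT)|] //.
  by move=> _ /andP[].
(* The imaginary reply consists of the part of [S] that is new there, padded to full size. *)
have [||S0 [sS sS0F cS0]] := @subset_of_card _ (S :\: B) (free M B :\ x)
    (minn b #|free M B :\ x|).
- exact: sub.
- rewrite geq_minr andbT.
  rewrite leq_min (subset_leq_card sub) andbT.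
  apply: leq_trans (subset_leq_card (subsetDl S B)) _.
  by rewrite cS (leq_trans (geq_minl _ _)).
apply: (IHk k' _ _ _ _ sM1 _ _ (H S0 sS0F cS0)).
  apply/subsetP=> z; rewrite !inE => /orP[zS|zB'].
    have [_|zB] := boolP (z \in B); first by rewrite orbT.
    by rewrite (subsetP sS z) // inE zB.
  by rewrite (subsetP sB) ?orbT.
by rewrite -ltnS; apply: leq_trans lek'; apply: free_move_card.
Qed.

Lemma breaker_wins_leq b b' : b' <= b ->
  breaker_wins board winning b' -> breaker_wins board winning b.
Proof.
move=> leb; apply: contra; apply: mw_mono => //.
by rewrite leqW // subset_leq_card // subsetDl.
Qed.

Lemma threshold_bias_exists b : breaker_wins board winning b ->
  exists2 b0, is_threshold_bias board winning b0 & b0 <= b.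
Proof.
move=> Hb; have ex : exists b, breaker_wins board winning b by exists b.
exists (ex_minn ex); case: ex_minnP => // b0 Hb0 minb0; last exact: minb0.
by move=> b1; split=> [/minb0//|leb]; apply: breaker_wins_leq leb Hb0.
Qed.
End Game.

Lemma disjoint_setU1 (T : finType) (x : T) (A B : {set T}) :
  [disjoint x |: A & B] = (x \notin B) && [disjoint A & B].
Proof.
by rewrite -disjointU1; apply: eq_disjoint => y; rewrite !inE.
Qed.

(** * Beck's potential criterion for Maker to meet every set of a family *)

Section HittingCriterion.
Local Open Scope ring_scope.
Variable K : realFieldType.

(** Convexity: powers of [lam] lie below their chord over [[0, b]]. When [lam ^+ b <= 2], claiming
    [m] elements of a set multiplies its weight by at most [1 + m / b]. *)
Lemma expr_chord (lam : K) (b m : nat) : 1 <= lam -> (m <= b)%N ->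
  b%:R * (lam ^+ m - 1) <= m%:R * (lam ^+ b - 1).
Proof.
move=> lam1; have tangent i : lam ^+ i - 1 <= i%:R * (lam ^+ i * (lam - 1)).
  elim: i => [|i IHi]; first by rewrite expr0 subrr mul0r.
  have := exprn_ege1 i lam1; set p := lam ^+ i in IHi *.
  rewrite exprS -/p -natr1 => p1; have i0 : 0 <= i%:R :> K by exact: ler0n.
  have : 0 <= i%:R * (p * ((lam - 1) * (lam - 1))).
    by rewrite !mulr_ge0 // ?subr_ge0 // (le_trans ler01).
  have : 0 <= p * ((lam - 1) * (lam - 1)).
    by rewrite !mulr_ge0 // ?subr_ge0 // (le_trans ler01).
  nra.
elim: b => [|b IHb] lemb.
  by move: lemb; rewrite leqn0 => /eqP->.
case: (ltngtP m b.+1) lemb => // [|->] // ltmb _.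
have {}IHb := IHb ltmb; have Hm := tangent m.
have lemb : lam ^+ m <= lam ^+ b by rewrite ler_weXn2l.
have : m%:R * (lam ^+ m * (lam - 1)) <= m%:R * (lam ^+ b * (lam - 1)).
  by rewrite ler_wpM2l ?ler0n // ler_wpM2r // subr_ge0.
by rewrite exprS -natr1; nra.
Qed.

Variables (T J : finType) (board : {set T}) (winning : pred {set T}).
Variables (P : pred J) (F : J -> {set T}) (lam : K) (b : nat).
Hypotheses (b_gt0 : (0 < b)%N) (lam_ge1 : 1 <= lam) (lamb : lam ^+ b <= 2).
Hypothesis F_board : forall j, P j -> F j \subset board.
Hypothesis F_hit : forall M : {set T}, M \subset board ->
  (forall j, P j -> exists2 x, x \in F j & x \in M) -> maker_has_won winning M.

(** Only sets that Maker has not met count. One that Breaker owns entirely weighs 1, so a full board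
    with potential below 1 is won by Maker. *)
Let pot (M B : {set T}) : K :=
  \sum_(j | P j && [disjoint F j & M]) lam ^- #|F j :\: B|.

Let danger (M B : {set T}) (x : T) : K :=
  \sum_(j | P j && [disjoint F j & M] && (x \in F j)) lam ^- #|F j :\: B|.

Let weight_ge0 (A : {set T}) : 0 <= lam ^- #|A|.
Proof. by rewrite invr_ge0 exprn_ge0 // (le_trans ler01). Qed.

Let pot_over (M B : {set T}) : M \subset board ->
  board \subset M :|: B -> pot M B < 1 -> maker_has_won winning M.
Proof.
move=> sM sb pot1; apply: F_hit => // j Pj.
have [dj|/pred0Pn[x /andP[xF xM]]] := boolP [disjoint F j & M]; last first.
  by exists x.
have FB : F j :\: B = set0.
  apply/eqP; rewrite setD_eq0; apply/subsetP=> x xF.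
  have := subsetP sb _ (subsetP (F_board Pj) _ xF).
  by rewrite inE => /orP[xM|//]; rewrite (disjointFr dj xF) in xM.
move: pot1; rewrite ltNge /pot (bigD1 j) /=; last by rewrite Pj.
by rewrite FB cards0 expr0 invr1 lerDl sumr_ge0.
Qed.

Let pot_move (M B : {set T}) (x : T) :
  pot (x |: M) B = pot M B - danger M B x.
Proof.
rewrite /pot /danger [in RHS](bigID (fun j => x \in F j)) /= addrC addrK.
apply: eq_bigl => j; rewrite -andbA; congr (_ && _).
rewrite disjoint_sym disjoint_setU1 disjoint_sym andbC; congr (_ && _).
Qed.

(** By [expr_chord] each unmet set gains at most [1 / b] of its weight per claimed element. Summed
    element by element, this is [1 / b] times at most [b] dangers, each at most [D]. *)
Let pot_reply (M B S : {set T}) (D : K) : [disjoint S & B] ->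
  (#|S| <= b)%N -> (forall y, y \in S -> danger M B y <= D) ->  0 <= D ->
  pot M (S :|: B) <= pot M B + D.
Proof.
move=> dSB cS leD D0; have b0 : 0 < b%:R :> K by rewrite ltr0n.
have step j : lam ^- #|F j :\: (S :|: B)| <=
    lam ^- #|F j :\: B| + b%:R^-1 * (\sum_(y in S | y \in F j) lam ^- #|F j :\: B|).
  set w := lam ^- _; set w' := lam ^- _.
  have cF : #|F j :\: B| = (#|F j :&: S| + #|F j :\: (S :|: B)|)%N.
    rewrite -(cardsID S (F j :\: B)) setDDl [B :|: S]setUC; congr (_ + _)%N.
    apply: eq_card => y; rewrite !inE andbC andbA.
    case: (boolP (y \in S)) => // yS; last by rewrite !andbF.
    by rewrite (disjointFr dSB yS) !andbT.
  have lam0 : lam != 0 by rewrite gt_eqF // (lt_le_trans ltr01).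
  have -> : w = w' * lam ^+ #|F j :&: S|.
    rewrite /w /w' cF exprD invfM mulrAC mulVf ?mul1r //.
    by rewrite expf_neq0.
  set m := #|F j :&: S|.
  have -> : \sum_(y in S | y \in F j) w' = w' *+ m.
    by rewrite -sumr_const; apply: eq_bigl => y; rewrite !inE andbC.
  have lemb : (m <= b)%N.
    by rewrite (leq_trans _ cS) // subset_leq_card // subsetIr.
  have := expr_chord lam_ge1 lemb => chord.
  have {}chord : b%:R * (lam ^+ m - 1) <= m%:R.
    apply: le_trans chord _; rewrite -[leRHS]mulr1 ler_wpM2l ?ler0n //.
    by rewrite lerBlDr.
  rewrite -[w' *+ m]mulr_natr mulrCA -[X in X + _]mulr1 -mulrDr.
  rewrite ler_wpM2l ?weight_ge0 // -lerBlDl.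
  by rewrite ler_pdivlMl.
rewrite /pot; apply: le_trans (ler_sum _ (fun j _ => step j)) _.
rewrite big_split /= lerD2l -mulr_sumr ler_pdivrMl //.
rewrite (exchange_big_dep (fun y => y \in S)) /=; last by move=> i y _ /andP[].
apply: (@le_trans _ _ (\sum_(y in S) D)).
  apply: ler_sum => y yS; apply: le_trans (leD y yS).
  by rewrite /danger le_eqVlt; apply/orP; left; apply/eqP; apply: eq_bigl => j; rewrite yS.
by rewrite sumr_const mulr_natl ler_wpMn2l.
Qed.

(* Beck's criterion: Maker always claims the element of largest danger, which
   keeps the potential from increasing over a full round. *)
Lemma hitting_criterion :
  \sum_(j | P j) lam ^- #|F j| < 1 -> maker_wins board winning b.
Proof.
move=> pot1; rewrite /maker_wins.
suff gen k M B : (#|board :\: (M :|: B)| <= k)%N -> M \subset board ->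
    [disjoint M & B] -> pot M B < 1 -> mw board winning b k M B.
  apply: gen; rewrite ?sub0set -?setI_eq0 ?setI0 ?setU0 ?setD0 //.
  rewrite /pot; under eq_bigr do rewrite setD0.
  by under eq_bigl do rewrite -setI_eq0 setI0 eqxx andbT.
elim: k M B => [|k IHk] M B lek sM dMB {}pot1.
  have F0 : board :\: (M :|: B) = set0 by apply/eqP; rewrite -cards_eq0 -leqn0.
  by rewrite mw_over // (pot_over sM _ pot1) // -setD_eq0 F0.
have [F0|F0] := eqVneq (board :\: (M :|: B)) set0.
  by rewrite mw_over // (pot_over sM _ pot1) // -setD_eq0 F0.
have [x0 x0F] := set0Pn _ F0.
have [x xF maxx] : exists2 x, x \in board :\: (M :|: B) &
    forall y, y \in board :\: (M :|: B) -> danger M B y <= danger M B x.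
  by case: (arg_maxP (danger M B) x0F) => x xF maxx; exists x.
apply/mwSP => //; exists x => // S sSF cS.
have xb : x \in board by move: xF; rewrite inE => /andP[].
have xB : x \notin B by move: xF; rewrite !inE negb_or => /andP[/andP[]].
have sS y : y \in S -> [/\ y \in board :\: (M :|: B), y \notin M, y \notin B & y != x].
  by move/(subsetP sSF); rewrite !inE negb_or => /and3P[-> /andP[-> ->] ->].
apply: IHk.
- by rewrite -ltnS; apply: leq_trans lek; apply: free_move_card.
- by rewrite subUset sub1set xb.
- rewrite disjoint_setU1 inE (negPf xB) orbF.
  apply/andP; split; first by apply/negP=> /sS[_ _ _]; rewrite eqxx.
  rewrite -setI_eq0; apply/eqP/setP=> y; rewrite !inE.
  apply/negP=> /andP[yM /orP[/sS[_]|yB]]; first by rewrite yM.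
  by rewrite (disjointFr dMB yM) in yB.
- apply: le_lt_trans pot1; rewrite -[leRHS](subrK (danger M B x)) -pot_move.
  apply: pot_reply; last exact: sumr_ge0.
  + rewrite -setI_eq0; apply/eqP/setP=> y; rewrite !inE.
    by apply/negP=> /andP[/sS[_ _ /negPf->]].
  + by rewrite cS geq_minl.
  move=> y /sS[yF _ _ _]; apply: le_trans (maxx y yF).
  rewrite /danger big_mkcond [leRHS]big_mkcond; apply: ler_sum => j _.
  rewrite disjoint_sym disjoint_setU1 [in leRHS]disjoint_sym.
  case: (P j) => //=; case: (x \in F j) => //=; case: ifP => // _.
Qed.
End HittingCriterion.

(** * The box game, in which Breaker fills one of several disjoint boxes *)

Section BoxGame.
Variables (T C : finType) (board : {set T}) (winning : pred {set T}).
Variables (col : T -> C) (b : nat).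
Let box i := [set x in board | col x == i].
Hypothesis win_box : forall (W : {set T}) i, winning W ->
  exists2 x, x \in W & x \in box i.

Let box_claimed k (M B : {set T}) i :
  [disjoint box i & M] -> box i \subset B -> ~~ mw board winning b k M B.
Proof.
move=> dM sB; apply/negP=> /mw_sound[W wW sW].
have [x xW xi] := win_box i wW; have := subsetP sW x xW.
by rewrite !inE (disjointFr dM xi) (subsetP sB x xi).
Qed.

(** Maker's move touches at most one box of [J]. With [r.+1] untouched boxes left after it, Breaker
    takes [b %/ r.+1] elements of each, or all that remain, which removes the last term of the sum.
    For a single box the sum is empty and the box is full. *)
Let box_move k (M B : {set T}) (J : {set C}) (r : nat) : #|J| = r.+1 ->
  (forall i, i \in J -> [disjoint box i & M]) ->
  (forall i, i \in J -> #|box i :\: B| <= \sum_(1 <= l < r.+1) b %/ l) ->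
  ~~ mw board winning b k M B.
Proof.
elim: r k M B J => [|r IHr] k M B J cJ dM leB.
  have /set0Pn[i iJ] : J != set0 by rewrite -card_gt0 cJ.
  apply: (box_claimed _ (dM i iJ)); rewrite -setD_eq0 -cards_eq0 -leqn0.
  by rewrite (leq_trans (leB i iJ)) // big_nil.
have [F0|F0] := eqVneq (board :\: (M :|: B)) set0.
  have /set0Pn[i iJ] : J != set0 by rewrite -card_gt0 cJ.
  apply: (box_claimed _ (dM i iJ)); apply/subsetP=> x xi.
  move/setP/(_ x): F0; rewrite !inE (disjointFr (dM i iJ) xi) /=.
  by move: xi; rewrite inE => /andP[-> _]; rewrite andbT => /negbFE.
case: k => [|k]; first by rewrite /= (negPf F0).
apply/negP=> /(mwSP _ _ _ F0)[x xF H].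
have [||J' [_ sJ' cJ']] := @subset_of_card _ set0 (J :\ col x) r.+1.
- exact: sub0set.
- by rewrite cards0 /=; have := cardsD1 (col x) J; case: (_ \in _); lia.
have JJ' i : i \in J' -> i \in J /\ i != col x.
  by move/(subsetP sJ'); rewrite !inE => /andP[].
have /fin_all_exists[f Hf] i : exists S : {set T}, S \subset box i :\: B /\
    #|S| = minn (b %/ r.+1) #|box i :\: B|.
  have [||S [_ sS cS]] := @subset_of_card _ set0 (box i :\: B)
    (minn (b %/ r.+1) #|box i :\: B|); first exact: sub0set.
    by rewrite cards0 geq_minr.
  by exists S.
pose S0 := \bigcup_(i in J') f i.
have cS0 : #|S0| <= b.
  apply: (@leq_trans (\sum_(i in J') b %/ r.+1)).
    rewrite /S0; elim/big_rec2: _ => [|i m A _ leA]; first by rewrite cards0.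
    apply: leq_trans (leq_card_setU _ _) _; rewrite leq_add //.
    by rewrite (Hf i).2 geq_minl.
  by rewrite sum_nat_const cJ' mulnC leq_divM.
have sS0 : S0 \subset board :\: (M :|: B) :\ x.
  apply/bigcupsP=> i iJ'; apply/subsetP=> y yf; have [iJ ix] := JJ' i iJ'.
  have := subsetP (Hf i).1 y yf; rewrite inE => /andP[yB yi].
  have := yi; rewrite !inE negb_or yB (disjointFr (dM i iJ) yi) /= => /andP[-> cy].
  by rewrite andbT; apply: contraNneq ix => <-; rewrite eq_sym.
have [||S [sS0S sSF cS]] := @subset_of_card _ S0 (board :\: (M :|: B) :\ x)
    (minn b #|board :\: (M :|: B) :\ x|) => //.
  by rewrite leq_min cS0 geq_minr subset_leq_card.
move: (H S sSF cS); apply/negP; apply: (IHr _ _ _ J') => // i iJ'.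
  have [iJ ix] := JJ' i iJ'; rewrite disjoint_sym disjoint_setU1 disjoint_sym.
  by rewrite dM // andbT !inE eq_sym (negPf ix) andbF.
have [iJ _] := JJ' i iJ'; have [sf cf] := Hf i.
have : #|box i :\: (S :|: B)| <= #|(box i :\: B) :\: f i|.
  apply: subset_leq_card; apply/subsetP=> y.
  rewrite !inE negb_or -!andbA => /and4P[yS -> -> ->]; rewrite !andbT.
  by apply: contra yS => yf; apply: (subsetP sS0S); apply/bigcupP; exists i.
rewrite [X in _ <= X]cardsD (setIidPr sf) cf; move/leq_trans; apply.
by move: (leB i iJ); rewrite big_nat_recr //=; clear; lia.
Qed.

Lemma box_breaker_wins : 0 < #|C| ->
  (forall i, #|box i| <= \sum_(1 <= l < #|C|) b %/ l) ->
  breaker_wins board winning b.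
Proof.
move=> C0 leb; apply: (@box_move _ _ _ [set: C] #|C|.-1).
- by rewrite cardsT prednK.
- by move=> i _; rewrite -setI_eq0 setI0.
by move=> i _; rewrite setD0 prednK.
Qed.
End BoxGame.

(** * Rado's theorem on independent transversals of families of vectors *)

Section Rado.
Variables (K : fieldType) (V : vectType K) (E I : finType) (v : E -> V).
Implicit Types (X Y : {set E}) (A : I -> {set E}) (J : {set I}).

Definition vspan X : {vspace V} := (\sum_(e in X) <[v e]>)%VS.
Definition vrank X := \dim (vspan X).

Lemma vspanS X Y : X \subset Y -> (vspan X <= vspan Y)%VS.
Proof.
move=> sXY; apply/subv_sumP=> e eX.
by rewrite /vspan (sumv_sup e) // (subsetP sXY).
Qed.

Lemma vrankS X Y : X \subset Y -> vrank X <= vrank Y.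
Proof. by move=> sXY; apply/dimvS/vspanS. Qed.

Lemma vrank_card X : vrank X <= #|X|.
Proof.
rewrite /vrank /vspan (leq_trans (dimv_leq_sum _ _ _)) // -sum1_card.
by apply: leq_sum => e _; rewrite dim_vline leq_b1.
Qed.

Lemma vrank_submod X Y : vrank (X :|: Y) + vrank (X :&: Y) <= vrank X + vrank Y.
Proof.
rewrite /vrank -(dimv_sum_cap (vspan X)) leq_add // dimvS //.
  apply/subv_sumP=> e; rewrite inE => /orP[eX|eY].
    by apply: subv_trans (addvSl _ _); rewrite /vspan (sumv_sup e).
  by apply: subv_trans (addvSr _ _); rewrite /vspan (sumv_sup e).
by rewrite subv_cap !vspanS ?subsetIl ?subsetIr.
Qed.

(* Rado's theorem for vector configurations: as long as some [A i0] contains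
   two elements, submodularity shows that one of them can be discarded. *)
Lemma rado A :
  (forall J, #|J| <= vrank (\bigcup_(i in J) A i)) ->
  exists2 f : I -> E, forall i, f i \in A i & #|I| <= vrank (f @: setT).
Proof.
have [m] := ubnP (\sum_i #|A i|); elim: m => // m IHm in A * => lem rkA.
have [small|] := boolP [forall i, #|A i| <= 1].
  have /fin_all_exists[f Af] i : exists e, A i = [set e].
    apply/cards1P; rewrite eqn_leq (forallP small i) /=.
    by apply: leq_trans (vrank_card _); have := rkA [set i]; rewrite big_set1 cards1.
  exists f => [i|]; first by rewrite Af set11.
  rewrite -cardsT; apply: leq_trans (rkA _) (vrankS _).
  by apply/bigcupsP=> i _; rewrite Af sub1set imset_f.
case/forallPn=> i0; rewrite -ltnNge => /card_gt1P[x [y [xA yA xy]]].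
pose D z i := if i == i0 then A i :\ z else A i.
have sDA z i : D z i \subset A i by rewrite /D; case: ifP => // _; apply: subsetDl.
have keep z : z \in A i0 -> (forall J, #|J| <= vrank (\bigcup_(i in J) D z i)) ->
    exists2 f : I -> E, forall i, f i \in A i & #|I| <= vrank (f @: setT).
  move=> zA rkD; have [|f fD rkf] := IHm (D z) _ rkD.
    rewrite ltnS in lem; apply: leq_trans lem.
    rewrite (bigD1 i0) //= [X in _ < X](bigD1 i0) //= /D eqxx.
    rewrite -addSn leq_add //; first by rewrite [X in _ <= X](cardsD1 z) zA.
    by apply: leq_sum => i /negPf->.
  by exists f => // i; apply: (subsetP (sDA z i)).
have [/forallP rkx|] := boolP [forall J : {set I}, #|J| <= vrank (\bigcup_(i in J) D x i)].
  exact: keep xA rkx.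
case/forallPn=> Jx; rewrite -ltnNge => ltx.
have [/forallP rky|] := boolP [forall J : {set I}, #|J| <= vrank (\bigcup_(i in J) D y i)].
  exact: keep yA rky.
case/forallPn=> Jy; rewrite -ltnNge => lty.
(* Away from [i0] the family is unchanged, so a violating [J] contains [i0]. *)
have inJ z J : vrank (\bigcup_(i in J) D z i) < #|J| -> i0 \in J.
  rewrite ltnNge => /negP H; apply/negPn/negP=> i0J; apply: H.
  apply: leq_trans (rkA J) (vrankS _); apply/bigcupsP=> i iJ.
  apply: subset_trans (bigcup_sup i iJ); rewrite /D.
  by case: eqP iJ i0J => // -> ->.
have i0x := inJ _ _ ltx; have i0y := inJ _ _ lty.
set X := \bigcup_(i in Jx) D x i in ltx; set Y := \bigcup_(i in Jy) D y i in lty.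
(* As [x] and [y] differ, each survives in one of the two reduced copies of [A i0]. *)
have sub_union : \bigcup_(i in Jx :|: Jy) A i \subset X :|: Y.
  apply/bigcupsP=> i; rewrite inE => iJ; apply/subsetP=> e eA; rewrite inE.
  have [ii0|ii0] := eqVneq i i0.
    rewrite ii0 in eA; have [ex|ex] := eqVneq e x.
      apply/orP; right; apply/bigcupP; exists i0 => //.
      by rewrite /D eqxx !inE eA ex xy.
    apply/orP; left; apply/bigcupP; exists i0 => //.
    by rewrite /D eqxx !inE eA ex.
  by case/orP: iJ => iJ; apply/orP; [left|right]; apply/bigcupP; exists i;
    rewrite // /D (negPf ii0).
have sub_inter : \bigcup_(i in (Jx :&: Jy) :\ i0) A i \subset X :&: Y.
  apply/bigcupsP=> i; rewrite !inE => /and3P[ii0 ix iy].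
  rewrite subsetI; apply/andP; split.
    by apply: subset_trans (bigcup_sup i ix); rewrite /D (negPf ii0).
  by apply: subset_trans (bigcup_sup i iy); rewrite /D (negPf ii0).
(* Rado's condition bounds the two ranks on the left of submodularity below by [#|Jx| + #|Jy| - 1],
   while those on the right sum to at most [#|Jx| + #|Jy| - 2]. *)
have := vrank_submod X Y; have := vrankS sub_union; have := vrankS sub_inter.
have := rkA (Jx :|: Jy); have := rkA ((Jx :&: Jy) :\ i0).
have := cardsUI Jx Jy; have := cardsD1 i0 (Jx :&: Jy); rewrite inE i0x i0y /=.
lia.
Qed.
End Rado.

(** * Rank of edge vectors and connectivity *)

Section GraphRank.
Variable n : nat.
Implicit Types (E : {set 'I_n * 'I_n}) (C W : {set 'I_n}) (u w : 'I_n).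
Local Open Scope ring_scope.
Let delta u : 'rV[rat]_n := delta_mx 0 u.

Definition edge_vec (e : 'I_n * 'I_n) : 'rV[rat]_n := delta e.1 - delta e.2.

Lemma adj_connect_sym E : connect_sym (adj E).
Proof. by apply: sym_connect_sym => x y; rewrite /adj orbC. Qed.

Let memv_edge E e : e \in E -> edge_vec e \in vspan edge_vec E.
Proof.
by move=> eE; rewrite memvE /vspan (sumv_sup e).
Qed.

Let memv_connect E u w : connect (adj E) u w -> delta u - delta w \in vspan edge_vec E.
Proof.
case/connectP=> p; elim: p u => [|x p IHp] u /=.
  by move=> _ ->; rewrite subrr mem0v.
move=> /andP[ux /IHp IH] /IH xw.
rewrite -[delta u](subrK (delta x)) -addrA memvD //.
case/orP: ux => [/memv_edge//|/memv_edge xu].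
by rewrite -opprB memvN.
Qed.

(** Telescoping along paths, the edge vectors together with the basis vectors of [W] span the whole
    space. *)
Lemma vrank_dominating E W :
  (forall u, exists2 w, w \in W & connect (adj E) u w) ->
  (n <= vrank edge_vec E + #|W|)%N.
Proof.
move=> dom; pose UW := (\sum_(w in W) <[delta w]>)%VS.
have delta_in u : delta u \in (vspan edge_vec E + UW)%VS.
  have [w wW uw] := dom u; rewrite -[delta u](subrK (delta w)).
  by apply: memv_add; [apply: memv_connect | rewrite memvE (sumv_sup w)].
have full : (fullv <= vspan edge_vec E + UW)%VS.
  apply/subvP=> x _; rewrite [x]row_sum_delta memv_suml // => j _.
  exact/memvZ/delta_in.
have := dimvS full; rewrite dimvf dim_matrix mul1r => /leq_trans; apply.
apply: leq_trans (dimv_add_leqif _ _) _; rewrite leq_add2l.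
exact: vrank_card.
Qed.

(** An edge has both or neither of its ends in [C], so its vector has coordinate sum 0 over [C]. *)
Let vspan_closed E C x : closed (adj E) C ->
  x \in vspan edge_vec E -> \sum_(u in C) x 0 u = 0.
Proof.
move=> clC /memv_sumP[c cE ->].
under eq_bigr do rewrite summxE; rewrite exchange_big big1 //= => e eE.
have /vlineP[k ->] := cE e eE; under eq_bigr do rewrite mxE.
rewrite -mulr_sumr; under eq_bigr do rewrite !mxE eqxx /=.
have Ce : (e.1 \in C) = (e.2 \in C).
  by apply: clC; rewrite /adj -surjective_pairing eE.
have sum1 u : \sum_(i in C) (i == u)%:R = (u \in C)%:R :> rat.
  rewrite big_mkcond (bigD1 u) //= eqxx big1 ?addr0 ?mulrb // => i /negPf->.
  by case: ifP.
by rewrite sumrB !sum1 Ce subrr mulr0.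
Qed.

Let dim_add_line (U : {vspace 'rV[rat]_n}) x : x \notin U ->
  (\dim U < \dim (U + <[x]>))%N.
Proof.
move=> xU; rewrite (ltn_leqif (dimv_leqif_sup (addvSl _ _))).
by rewrite subv_add subvv -memvE.
Qed.

(** If [u] and [w] lie in different components, adding [delta u] and then [delta w] raises the
    dimension twice, to more than [n]; coordinate sums over the component of [u] and over its
    complement show this. *)
Lemma connected_of_vrank E u w :
  (n.-1 <= vrank edge_vec E)%N -> connect (adj E) u w.
Proof.
move=> rkE; apply/negPn/negP=> nuw.
pose C := [set x | connect (adj E) u x].
have clC : closed (adj E) C.
  by move=> x y xy; rewrite !inE; apply: (same_connect1r (@adj_connect_sym E) xy).
have clC' : closed (adj E) (~: C) by move=> x y xy; rewrite !in_setC (clC _ _ xy).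
have sum1 (A : {set 'I_n}) z : \sum_(i in A) delta z 0 i = (z \in A)%:R.
  rewrite big_mkcond (bigD1 z) //= mxE !eqxx /= big1 ?addr0 ?mulrb //.
  by move=> i /negPf iz; rewrite mxE iz andbF if_same.
have uC : u \in C by rewrite inE connect0.
have wC : w \notin C by rewrite inE.
have uU : delta u \notin vspan edge_vec E.
  apply/negP=> /(vspan_closed clC); rewrite sum1 uC => /eqP; by rewrite oner_eq0.
have wU : delta w \notin (vspan edge_vec E + <[delta u]>)%VS.
  apply/negP=> /memv_addP[x xE [_ /vlineP[k ->] dw]].
  have := sum1 (~: C) w; rewrite inE wC dw; under eq_bigr do rewrite 2!mxE.
  rewrite big_split /= (vspan_closed clC' xE) -mulr_sumr sum1 inE uC mulr0 addr0.
  by move/eqP; rewrite eq_sym oner_eq0.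
have := subvf (vspan edge_vec E + <[delta u]> + <[delta w]>).
move/dimvS; rewrite dimvf dim_matrix mul1r => len.
have lt1 := leq_ltn_trans rkE (dim_add_line uU).
have := leq_trans (leq_ltn_trans lt1 (dim_add_line wU)) len.
by clear; lia.
Qed.
End GraphRank.

(** * Barriers whose hitting forces a rainbow spanning tree *)

Section RainbowTree.
Variable n : nat.
Local Notation color := 'I_n.-1.
Implicit Types (M : {set RS_elt n}) (I : {set color}) (W : {set 'I_n}).

Definition color_edges M (i : color) : {set 'I_n * 'I_n} := [set e | (i, e) \in M].

(** A transversal of rank [n.-1] consists of [n.-1] distinct edges and connects all vertices. *)
Lemma rainbow_tree_of_rado M : M \subset RS_board n ->
  (forall I, #|I| <= vrank (@edge_vec n) (\bigcup_(i in I) color_edges M i)) ->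
  maker_has_won (@is_rainbow_spanning_tree n) M.
Proof.
move=> sM /rado[f fM rkf]; rewrite card_ord in rkf.
pose S : {set RS_elt n} := [set (i, f i) | i in [set: color]].
have fiM i : (i, f i) \in M by have := fM i; rewrite inE.
have sSM : S \subset M by apply/subsetP=> _ /imsetP[i _ ->].
apply/existsP; exists S; rewrite sSM andbT /is_rainbow_spanning_tree.
have proj : [set x.2 | x in S] = f @: setT by rewrite -imset_comp.
rewrite (subset_trans sSM sM) proj /spanning_tree /=; apply/and3P; split.
- apply/forallP=> i; apply/cards1P; exists (i, f i); apply/setP=> x.
  rewrite !inE; apply/andP/eqP=> [[/imsetP[k _ ->] /= /eqP->]//|->].
  by rewrite /= eqxx imset_f.
- apply/andP; split; last first.
    rewrite eqn_leq -{1}[X in _ <= X.-1]card_ord.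
    rewrite (leq_trans rkf (vrank_card _ _)) andbT.
    by rewrite (leq_trans (leq_imset_card _ _)) // cardsT !card_ord.
  apply/forallP=> e; apply/implyP=> /imsetP[i _ ->].
  by have := subsetP sM _ (fiM i); rewrite inE.
apply/forallP=> u; apply/forallP=> w; exact: connected_of_vrank.
Qed.

Definition barrier I (r : rel 'I_n) : {set RS_elt n} :=
  [set x : RS_elt n | [&& x.1 \in I, x.2.1 < x.2.2 & r x.2.1 x.2.2]].

(* Barriers are indexed by triples: [(true, W, J)] stands for the edges with
   colour in [J] inside [W], and [(false, W, J)] for those leaving [W]. *)
Definition barrier_index : finType := (bool * {set 'I_n} * {set color})%type.

Definition barrier_of (t : barrier_index) : {set RS_elt n} :=
  let: (inside, W, J) := t in
  barrier J (if inside then fun u v => (u \in W) && (v \in W)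
             else fun u v => (u \in W) != (v \in W)).

(** The equations between [#|W|] and [#|J|] allow the weight of a barrier to be bounded by a
    function of [W] times a function of [J]. *)
Definition is_barrier (t : barrier_index) : bool :=
  let: (inside, W, J) := t in
  if inside then [&& 0 < #|J|, #|W| + #|J| == n.+1 & 4 * #|J| <= 3 * n]
  else [&& 0 < #|W|, #|W| + #|J| == n & 2 * #|W| <= n].

Lemma barrier_of_board t : barrier_of t \subset RS_board n.
Proof.
case: t => [[inside W] J]; apply/subsetP=> x.
by rewrite !inE => /and3P[].
Qed.

(** Take a largest union [W] of components with at most [n / 2] vertices. If it had fewer than
    [n - j < n / 4], adding any further component would exceed [n / 2]. Then the complement of [W]
    and one such component is a larger admissible union. *)
Lemma large_closed_set (E : {set 'I_n * 'I_n}) j :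
  j < n -> 3 * n < 4 * j -> vrank (@edge_vec n) E < j ->
  exists2 W : {set 'I_n}, closed (adj E) W & n - j <= #|W| /\ 2 * #|W| <= n.
Proof.
move=> ltjn ltnj rkE.
pose ok W := [forall x, forall y, adj E x y ==> ((x \in W) == (y \in W))] &&
  (2 * #|W| <= n).
have okP W : reflect (closed (adj E) W /\ 2 * #|W| <= n) (ok W).
  apply: (iffP andP) => -[H leW]; split=> //.
    move=> x y xy; apply/eqP; have /forallP/(_ y)/implyP := forallP H x; exact.
  by apply/forallP=> x; apply/forallP=> y; apply/implyP=> /H->.
have ok0 : ok set0.
  by apply/okP; split=> [x y _|]; rewrite ?inE ?cards0.
case: (arg_maxnP (fun W : {set 'I_n} => #|W|) ok0) => W /okP[clW leW] maxW.
exists W => //; split=> //; rewrite leqNgt; apply/negP=> ltW.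
pose comp v := [set x | connect (adj E) v x].
have clcomp v : closed (adj E) (comp v).
  by move=> x y xy; rewrite !inE; apply: (same_connect1r (@adj_connect_sym _ E) xy).
have compW v : v \notin W -> [disjoint comp v & W].
  move=> vW; rewrite -setI_eq0; apply/eqP/setP=> x; rewrite !inE.
  apply/negP=> /andP[vx xW]; move: vW; rewrite (closed_connect clW vx) xW //.
have big v : v \notin W -> n < 2 * (#|W| + #|comp v|).
  move=> vW; rewrite ltnNge; apply/negP=> small.
  have cU : #|W :|: comp v| = #|W| + #|comp v|.
    by rewrite cardsU [W :&: _]setIC (disjoint_setI0 (compW v vW)) cards0 subn0.
  have /maxW : ok (W :|: comp v).
    apply/okP; rewrite cU; split=> // x y xy.
    by rewrite !in_setU (clW _ _ xy) (clcomp v _ _ xy).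
  rewrite cU; have : 0 < #|comp v| by apply/card_gt0P; exists v; rewrite inE.
  lia.
have [v0 v0W] : exists v0, v0 \notin W.
  have /set0Pn[v] : ~: W != set0.
    by rewrite -card_gt0; have := cardsC W; rewrite card_ord; lia.
  by rewrite inE; exists v.
have [v1 v1W v01] : exists2 v1, v1 \notin W & ~~ connect (adj E) v0 v1.
  have [/existsP[v /andP[]]|no] := boolP [exists v, (v \notin W) && ~~ connect (adj E) v0 v].
    by exists v.
  (* If [v0] reached every vertex outside [W], the rank would be at least [n - #|W| - 1], which is
     at least [j]. *)
  have := @vrank_dominating _ E (v0 |: W); rewrite cardsU1 v0W => H.
  suff : n <= vrank (@edge_vec n) E + (1 + #|W|) by lia.
  apply: H => u; have [uW|uW] := boolP (u \in W).
    by exists u; rewrite ?connect0 // !inE uW orbT.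
  exists v0; first by rewrite !inE eqxx.
  rewrite adj_connect_sym; apply: contraNT no => nu.
  by apply/existsP; exists u; rewrite uW.
pose D := ~: (W :|: comp v0).
have cD : #|D| = n - (#|W| + #|comp v0|).
  rewrite /D cardsCs setCK card_ord cardsU [W :&: _]setIC.
  by rewrite (disjoint_setI0 (compW v0 v0W)) cards0 subn0.
have leD : #|comp v1| <= #|D|.
  apply: subset_leq_card; apply/subsetP=> x xv1.
  rewrite !inE (disjointFr (compW v1 v1W) xv1) /=.
  apply: contra v01 => v0x; apply: connect_trans v0x _.
  by rewrite adj_connect_sym; move: xv1; rewrite inE.
have := big v0 v0W; have := big v1 v1W => b1 b0.
have /maxW : ok D.
  apply/okP; split; last by lia.
  by move=> x y xy; rewrite !inE (clW _ _ xy) (same_connect1r (@adj_connect_sym _ E) xy).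
lia.
Qed.

Lemma rainbow_tree_of_hitting M : M \subset RS_board n ->
  (forall t, is_barrier t -> exists2 x, x \in barrier_of t & x \in M) ->
  maker_has_won (@is_rainbow_spanning_tree n) M.
Proof.
move=> sM hit; apply: rainbow_tree_of_rado => // I.
rewrite leqNgt; apply/negP; set E := \bigcup_(i in I) _ => rkE.
have adjE i u v (r : rel 'I_n) : (i, (u, v)) \in barrier I r ->
    (i, (u, v)) \in M -> [/\ adj E u v, r u v & u != v].
  rewrite inE /= => /and3P[iI uv ruv] iM; split=> //.
    by apply/orP; left; apply/bigcupP; exists i; rewrite // inE.
  by apply: contraTneq uv => ->; rewrite ltnn.
have I0 : 0 < #|I| by apply: leq_ltn_trans rkE.
have In : #|I| <= n.-1 by rewrite -[n.-1 in X in _ <= X]card_ord max_card.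
have [leI|ltI] := leqP (4 * #|I|) (3 * n).
  pose W0 := [set u | roots (adj E) u].
  have W0n : n <= vrank (@edge_vec n) E + #|W0|.
    apply: vrank_dominating => u; exists (fingraph.root (adj E) u); last exact: connect_root.
    by rewrite inE roots_root //; apply: adj_connect_sym.
  (* [W0] has one vertex per component, so an edge of [E] inside [W] would join a root to itself. *)
  have [||W [_ sW cW]] := @subset_of_card _ set0 W0 (n.+1 - #|I|).
  - exact: sub0set.
  - rewrite cards0 leq_subLR; apply: leq_ltn_trans W0n _.
    by rewrite ltn_add2r.
  have [|[i [u v]] xB xM] := hit (true, W, I).
    by rewrite /= I0 leI cW andbT subnK //; lia.
  have [uv /andP[uW vW] neq_uv] :=
    adjE i u v (fun u v => (u \in W) && (v \in W)) xB xM.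
  move: neq_uv; apply/negP/negPn.
  have := subsetP sW _ uW; have := subsetP sW _ vW.
  rewrite !inE /roots => /eqP<- /eqP<-; rewrite root_connect ?connect1 //.
  exact: adj_connect_sym.
have [|W clW [leW ltW]] := @large_closed_set E #|I| _ ltI rkE; first lia.
(* Colours are dropped until the equation in [is_barrier] holds; an edge hitting the barrier would
   leave the closed set [W]. *)
have [||I' [_ sI' cI']] := @subset_of_card _ set0 I (n - #|W|).
- exact: sub0set.
- by rewrite cards0 leq_subLR addnC -leq_subLR.
have [|[i [u v]] xB xM] := hit (false, W, I').
  rewrite /= cI' ltW subnKC ?eqxx ?andbT; last exact: leq_trans (leq_pmull _ _) ltW.
  by apply: leq_trans leW; rewrite subn_gt0; lia.
have [|uv /eqP uvW _] := adjE i u v (fun u v => (u \in W) != (v \in W)) _ xM.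
  by move: xB; rewrite !inE /= => /and3P[/(subsetP sI')-> -> ->].
by rewrite (clW _ _ uv) in uvW.
Qed.
End RainbowTree.

(** * Sizes of the barriers *)

Lemma card_barrier n (I : {set 'I_n.-1}) (r : rel 'I_n) : symmetric r ->
  2 * #|barrier I r| = #|I| * #|[set p : 'I_n * 'I_n | r p.1 p.2 & p.1 != p.2]|.
Proof.
move=> symr; pose A := [set p : 'I_n * 'I_n | p.1 < p.2 & r p.1 p.2].
have -> : barrier I r = setX I A.
  by apply/setP=> -[i p]; rewrite !inE.
rewrite cardsX mulnCA; congr (_ * _).
pose swap (p : 'I_n * 'I_n) := (p.2, p.1).
have swapK : involutive swap by case.
rewrite mul2n -addnn -{2}(card_imset (mem A) (inv_inj swapK)).
have -> : [set p : 'I_n * 'I_n | r p.1 p.2 & p.1 != p.2] = A :|: swap @: A.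
  apply/setP=> -[u v]; rewrite inE in_setU.
  have -> : ((u, v) \in swap @: A) = ((v, u) \in A).
    by rewrite -[(u, v)]/(swap (v, u)) mem_imset //; apply: inv_inj.
  rewrite !inE /= [r v u]symr -(inj_eq val_inj) neq_ltn -andb_orl andbC.
  by [].
rewrite cardsU (_ : A :&: _ = set0) ?cards0 ?subn0 //.
apply/setP=> -[u v]; rewrite in_setI in_set0.
have -> : ((u, v) \in swap @: A) = ((v, u) \in A).
  by rewrite -[(u, v)]/(swap (v, u)) mem_imset //; apply: inv_inj.
by rewrite !inE /=; case: ltngtP; rewrite ?andbF.
Qed.

Lemma card_barrier_inside n (W : {set 'I_n}) (I : {set 'I_n.-1}) :
  #|I| * (#|W| * #|W|.-1) <= 2 * #|barrier_of (true, W, I)|.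
Proof.
rewrite card_barrier; last by move=> u v; rewrite andbC.
rewrite leq_mul2l; apply/orP; right.
have -> : [set p : 'I_n * 'I_n | (p.1 \in W) && (p.2 \in W) & p.1 != p.2]
    = setX W W :\: [set (u, u) | u in W].
  apply/setP=> -[u v]; rewrite !inE /= andbC.
  case: (boolP ((u \in W) && (v \in W))) => [/andP[uW vW]|]; last by rewrite !andbF.
  rewrite !andbT; congr (~~ _); apply/eqP/imsetP => [->|[w _ [-> ->]]] //.
  by exists v.
rewrite -subn1 mulnBr muln1 -cardsX -(card_in_imset (f := fun u => (u, u)) (D := mem W)).
  by rewrite cardsD leq_sub2l // subset_leq_card // subsetIr.
by move=> u v _ _ [].
Qed.

Lemma card_barrier_leaving n (W : {set 'I_n}) (I : {set 'I_n.-1}) :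
  #|barrier_of (false, W, I)| = #|I| * (#|W| * (n - #|W|)).
Proof.
apply/eqP; rewrite -(eqn_pmul2l (m := 2)) //; apply/eqP.
rewrite card_barrier; last by move=> u v; rewrite eq_sym.
rewrite mulnCA; congr (_ * _).
have -> : [set p : 'I_n * 'I_n | (p.1 \in W) != (p.2 \in W) & p.1 != p.2]
    = setX W (~: W) :|: setX (~: W) W.
  apply/setP=> -[u v]; rewrite !inE /=.
  have [->|_] := eqVneq u v; first by rewrite eqxx /=; case: (_ \in _).
  by rewrite andbT; case: (u \in W); case: (v \in W).
rewrite cardsU (_ : _ :&: _ = set0) ?cards0 ?subn0.
  have cC : #|~: W| = n - #|W| by rewrite cardsCs setCK card_ord.
  by rewrite !cardsX cC [X in _ + X]mulnC addnn mul2n.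
by apply/setP=> -[u v]; rewrite !inE /=; case: (u \in W); case: (v \in W).
Qed.

(** * Binomial sums over subsets *)

Section BarrierSum.
Local Open Scope ring_scope.
Variable K : realFieldType.

Lemma sum_subsets_expr (T : finType) (y : K) :
  \sum_(A : {set T}) y ^+ #|A| = (1 + y) ^+ #|T|.
Proof.
rewrite addrC -prodr_const bigA_distr; apply: eq_bigr => A _.
by rewrite -big_mkcond prodr_const.
Qed.

Lemma expr_1Dinv_le4 (n : nat) : (0 < n)%N -> (1 + n%:R^-1) ^+ n <= 4 :> K.
Proof.
move=> n0; have N0 : 0 < n%:R :> K by rewrite ltr0n.
pose x : K := (2 * n%:R)^-1; have x0 : 0 <= x by rewrite invr_ge0 mulr_ge0 // ltW.
(* At [m = n] the second factor is [1 / 2], so [(1 + x) ^+ n <= 2]; moreover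
   [1 + 1 / n <= (1 + x) ^+ 2]. *)
have step m : (1 + x) ^+ m * (1 - m%:R * x) <= 1.
  elim: m => [|m IHm]; first by rewrite expr0 mul1r mul0r subr0.
  apply: le_trans IHm; rewrite exprSr -mulrA ler_wpM2l ?exprn_ge0 ?addr_ge0 //.
  rewrite -natr1; have : 0 <= m%:R * (x * x) by rewrite !mulr_ge0.
  by have := mulr_ge0 x0 x0; lra.
have nx : n%:R * x = 2^-1 by rewrite /x invfM mulrCA divff ?mulr1 // gt_eqF.
have le2 : (1 + x) ^+ n <= 2 by have := step n; rewrite nx; lra.
have : (1 + n%:R^-1) ^+ n <= ((1 + x) ^+ 2) ^+ n.
  rewrite lerXn2r ?nnegrE ?addr_ge0 ?invr_ge0 ?exprn_ge0 ?addr_ge0 ?(ltW N0) //.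
  have -> : n%:R^-1 = x + x.
    by rewrite /x invfM -mulrDl -[2^-1]div1r -splitr mul1r.
  by have := mulr_ge0 x0 x0; rewrite expr2; lra.
move/le_trans; apply; rewrite exprAC expr2.
have : 0 <= (1 + x) ^+ n by rewrite exprn_ge0 // addr_ge0.
nra.
Qed.
End BarrierSum.

(** * The initial potential of the barriers is below 1 *)

Section MakerSide.
Local Open Scope ring_scope.
Variables (K : realFieldType) (n : nat) (lam : K).
Local Notation N := (n%:R : K).
Hypotheses (n_ge64 : (64 <= n)%N) (n_big : 8 ^+ 16 <= N).
Hypotheses (lam_ge1 : 1 <= lam) (lam_big : N ^+ 8 <= lam ^+ (n ^ 2)).

Let N0 : 0 < N. Proof. by rewrite ltr0n; lia. Qed.
Let lam0 : 0 <= lam. Proof. exact: le_trans ler01 lam_ge1. Qed.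

(** Compare eighth powers. The 8 is what leaving barriers with [#|W| = t] require: their size is at
    least [t * n ^ 2 / 4], with equality at [t = n / 2], and their weight should be at most
    [N ^- (2 * t)]. *)
Let lam_expr (s m : nat) : (n ^ 2 * m <= 8 * s)%N -> N ^+ m <= lam ^+ s.
Proof.
move=> les; rewrite -(@ler_pXn2r _ 8) ?nnegrE ?exprn_ge0 ?(ltW N0) // -!exprM.
apply: (@le_trans _ _ (lam ^+ (n ^ 2 * m))).
  rewrite mulnC (exprM _ 8) (exprM _ (n ^ 2)).
  by apply: lerXn2r lam_big; rewrite nnegrE exprn_ge0 // ltW.
by rewrite [(s * 8)%N]mulnC ler_weXn2l.
Qed.

(** The left side is at most [8 ^+ n], whose 16th power is at most [N ^+ n] by [n_big]; hence
    [128 = 8 * 16]. *)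
Let lam_exprn (s : nat) : (n ^ 2 * n <= 128 * s)%N -> N * 4 ^+ n <= lam ^+ s.
Proof.
move=> les; apply: (@le_trans _ _ (8 ^+ n)).
  rewrite [8 in leRHS](_ : _ = 2 * 4); last by rewrite -natrM.
  rewrite exprMn ler_wpM2r ?exprn_ge0 // -natrX ler_nat.
  exact/ltnW/ltn_expl.
rewrite -(@ler_pXn2r _ 16) ?nnegrE ?exprn_ge0 // exprAC -(exprM lam).
apply: (@le_trans _ _ (N ^+ n)); last by apply: lam_expr; lia.
by apply: lerXn2r n_big; rewrite nnegrE ?exprn_ge0 // ltW.
Qed.

(* The second term accounts for the range [n < 4 |I| <= 3 n], where the size of
   the barrier is of order [n ^ 3] and counting all pairs [(W, I)] is enough;
   [8 ^+ 16 <= N] is only needed there. *)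
Let weight_inside (W : {set 'I_n}) (I : {set 'I_n.-1}) : is_barrier (true, W, I) ->
  lam ^- #|barrier_of (true, W, I)| <=
    N^-1 * (N^-1 ^+ #|~: W| * N^-1 ^+ #|I|) + N^-1 * 4^-1 ^+ n.
Proof.
move=> /and3P[I0 /eqP cWI leI]; have := card_barrier_inside W I.
have cC : #|~: W| = #|I|.-1.
  by rewrite cardsCs setCK card_ord; move: cWI I0; clear; lia.
rewrite cC; have {cWI} -> : #|W| = (n.+1 - #|I|)%N by rewrite -cWI addnK.
move: #|barrier_of _| #|I| I0 leI => s j j0 lej les.
have [small|large] := leqP (4 * j) n.
  have : N ^+ (2 * j) <= lam ^+ s by apply: lam_expr; nia.
  have Nj : 0 < N ^+ (2 * j) by rewrite exprn_gt0.
  rewrite -lef_pV2 ?posrE // ?(lt_le_trans Nj) //; last by apply: lam_expr; nia.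
  move/le_trans; apply; apply: ler_wpDr.
    by rewrite mulr_ge0 ?exprn_ge0 ?invr_ge0 ?(ltW N0).
  rewrite -exprD -exprS exprVn (_ : (_.-1 + _).+1 = (2 * j)%N) //; lia.
have le4 : N * 4 ^+ n <= lam ^+ s.
  (* All three factors are at least [n]; [4 ^ 3] and the 2 in [card_barrier_inside] make up the
     128. *)
  have cube : (n * (n * n) <= (4 * j) * ((4 * (n.+1 - j)) * (4 * (n.+1 - j).-1)))%N.
    by rewrite !leq_mul //; lia.
  by apply: lam_exprn; move: les cube; rewrite -mulnn; lia.
have N4 : 0 < N * 4 ^+ n by rewrite mulr_gt0 // exprn_gt0.
apply: ler_wpDl; first by rewrite !mulr_ge0 ?exprn_ge0 ?invr_ge0 ?(ltW N0).
by rewrite exprVn -invfM lef_pV2 ?posrE // (lt_le_trans N4).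
Qed.

Let weight_leaving (W : {set 'I_n}) (I : {set 'I_n.-1}) : is_barrier (false, W, I) ->
  lam ^- #|barrier_of (false, W, I)| <= N^-1 * (N^-1 ^+ #|W| * N^-1 ^+ #|~: I|).
Proof.
move=> /and3P[W0 /eqP cWI leW]; rewrite card_barrier_leaving.
have -> : #|~: I| = #|W|.-1.
  by rewrite cardsCs setCK card_ord; move: cWI W0; clear; lia.
have -> : #|I| = (n - #|W|)%N by move: cWI; clear; lia.
move: #|W| W0 leW => t t0 let2.
have le2t : N ^+ (2 * t) <= lam ^+ ((n - t) * (t * (n - t))).
  have sq : (n * n <= (2 * (n - t)) * (2 * (n - t)))%N by rewrite leq_mul //; lia.
  apply: lam_expr; rewrite -mulnn.
  by apply: leq_trans (leq_mul sq (leqnn (2 * t))) _; lia.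
rewrite -exprD -exprS exprVn (_ : (t + t.-1).+1 = (2 * t)%N); last by lia.
by rewrite lef_pV2 ?posrE ?(lt_le_trans _ le2t) ?exprn_gt0.
Qed.

(* Both weight bounds are products of a function of [W] and a function of [I], so
   that the binomial theorem sums them over all pairs, barriers or not. *)
Lemma barrier_sum_lt1 : \sum_(t | @is_barrier n t) lam ^- #|barrier_of t| < 1.
Proof.
pose y := N^-1; have y0 : 0 <= y by rewrite invr_ge0 ltW.
have pow4 m : (m <= n)%N -> (1 + y) ^+ m <= 4.
  move=> lem; apply: le_trans (@expr_1Dinv_le4 K n _); last by lia.
  by rewrite ler_weXn2l // lerDl.
pose g (t : barrier_index n) : K := let: (inside, W, J) := t in
  if inside then y * (y ^+ #|~: W| * y ^+ #|J|) + y * 4^-1 ^+ n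
  else y * (y ^+ #|W| * y ^+ #|~: J|).
have g0 t : 0 <= g t.
  case: t => [[[] W] J] /=; by rewrite ?addr_ge0 ?mulr_ge0 ?exprn_ge0 ?invr_ge0.
apply: (@le_lt_trans _ _ (\sum_t g t)).
  rewrite big_mkcond; apply: ler_sum => t _; case: ifP => // Bt.
  by case: t Bt => [[[] W] J]; [apply: weight_inside | apply: weight_leaving].
have -> : \sum_t g t = \sum_(W : {set 'I_n}) \sum_(J : {set 'I_n.-1}) g (true, W, J)
    + \sum_(W : {set 'I_n}) \sum_(J : {set 'I_n.-1}) g (false, W, J).
  transitivity (\sum_(b : bool) \sum_(W : {set 'I_n}) \sum_(J : {set 'I_n.-1}) g (b, W, J)).
    by rewrite pair_bigA /= pair_bigA; apply: eq_bigr => -[[b W] J].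
  by rewrite big_bool.
have cards m : \sum_(A : {set 'I_m}) y ^+ #|A| = (1 + y) ^+ m.
  by rewrite sum_subsets_expr card_ord.
have cardsC m : \sum_(A : {set 'I_m}) y ^+ #|~: A| = (1 + y) ^+ m.
  by rewrite -cards [RHS](reindex_inj (@setC_inj _)).
have csum m (c : K) : \sum_(A : {set 'I_m}) c = c * 2 ^+ m.
  have := sum_subsets_expr 'I_m (1 : K); rewrite card_ord -[1 + 1]/2 => <-.
  by rewrite mulr_sumr; apply: eq_bigr => A _; rewrite expr1n mulr1.
have -> : \sum_(W : {set 'I_n}) \sum_(J : {set 'I_n.-1}) g (true, W, J) =
    y * ((1 + y) ^+ n * (1 + y) ^+ n.-1) + y * (4^-1 ^+ n * 2 ^+ n.-1 * 2 ^+ n).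
  transitivity (\sum_(W : {set 'I_n})
      (y * (1 + y) ^+ n.-1 * y ^+ #|~: W| + y * (4^-1 ^+ n * 2 ^+ n.-1))).
    apply: eq_bigr => W _; rewrite /g big_split /= -!mulr_sumr cards csum.
    by rewrite -!mulrA [y ^+ _ * _]mulrC.
  rewrite big_split /= -mulr_sumr cardsC csum.
  by rewrite -!mulrA [(1 + y) ^+ n * _]mulrC.
have -> : \sum_(W : {set 'I_n}) \sum_(J : {set 'I_n.-1}) g (false, W, J) =
    y * ((1 + y) ^+ n * (1 + y) ^+ n.-1).
  under eq_bigr do rewrite /g -!mulr_sumr cardsC.
  by rewrite -mulr_sumr -mulr_suml cards.
have p1 := pow4 n (leqnn n); have p2 := pow4 n.-1 (leq_pred n).
have q1 : 0 <= (1 + y) ^+ n by rewrite exprn_ge0 ?addr_ge0.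
have q2 : 0 <= (1 + y) ^+ n.-1 by rewrite exprn_ge0 ?addr_ge0.
have pp : (1 + y) ^+ n * (1 + y) ^+ n.-1 <= 16.
  have := ler_pM q1 q2 p1 p2; lra.
have le1 : 4^-1 ^+ n * 2 ^+ n.-1 * 2 ^+ n <= 1 :> K.
  apply: (@le_trans _ _ (4^-1 ^+ n * 2 ^+ n * 2 ^+ n)).
    rewrite ler_wpM2r ?exprn_ge0 // ler_wpM2l ?exprn_ge0 ?invr_ge0 //.
    by rewrite ler_weXn2l ?leq_pred // ler1n.
  by rewrite -!exprMn -mulrA -natrM mulVf ?expr1n // pnatr_eq0.
(* 33 is 16 + 1 for the two terms of the inside barriers, plus 16 for the leaving ones. *)
have y33 : y * 33 < 1.
  by rewrite mulrC ltr_pdivrMr // mul1r ltr_nat; apply: leq_trans n_ge64.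
have := ler_wpM2l y0 pp; have := ler_wpM2l y0 le1.
move: y33; lra.
Qed.
End MakerSide.

(** * Winning criteria for both players in the rainbow game *)

Lemma maker_wins_rainbow (K : realFieldType) (n b : nat) (lam : K) :
  (64 <= n)%N -> (8 ^+ 16 <= n%:R :> K)%R -> (0 < b)%N ->
  (1 <= lam)%R -> (lam ^+ b <= 2)%R -> (n%:R ^+ 8 <= lam ^+ (n ^ 2))%R ->
  maker_wins (RS_board n) (@is_rainbow_spanning_tree n) b.
Proof.
move=> n64 nbig b0 lam1 lamb lamn.
apply: (@hitting_criterion K _ _ (RS_board n) _ (@is_barrier n) (@barrier_of n) lam) => //.
- by move=> t _; apply: barrier_of_board.
- by move=> M sM; apply: rainbow_tree_of_hitting.
exact: barrier_sum_lt1.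
Qed.

(** The boxes are the [n.-1] colour classes: every rainbow tree has an edge in each of them. *)
Lemma breaker_wins_rainbow (n b : nat) : 1 < n ->
  (n * n.-1 <= 2 * \sum_(1 <= l < n.-1) b %/ l)%N ->
  breaker_wins (RS_board n) (@is_rainbow_spanning_tree n) b.
Proof.
move=> n1 leb; apply: (@box_breaker_wins _ _ _ _ (fun x : RS_elt n => x.1)) => [W i||i].
- move=> /andP[/andP[sW /forallP/(_ i)/cards1P[x Wx] _]].
  have : x \in [set x in W | x.1 == i] by rewrite Wx set11.
  rewrite inE => /andP[xW xi]; exists x => //.
  by rewrite inE xi (subsetP sW).
- by rewrite card_ord; lia.
rewrite card_ord -(leq_pmul2l (m := 2)) //; apply: leq_trans leb.
have -> : [set x in RS_board n | x.1 == i] = barrier [set i] (fun _ _ => true).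
  by apply/setP=> x; rewrite !inE andbT andbC.
rewrite card_barrier // cards1 mul1n.
have -> : [set p : 'I_n * 'I_n | true & p.1 != p.2] = ~: [set (u, u) | u in [set: 'I_n]].
  apply/setP=> -[u v]; rewrite !inE /=; congr (~~ _).
  apply/eqP/imsetP => [->|[w _ [-> ->]]] //; by exists v; rewrite ?inE.
rewrite cardsCs setCK card_prod card_imset ?cardsT ?card_ord; last by move=> u v [].
by lia.
Qed.

(* Translation of the criteria into real logarithms *)
From mathcomp Require Import Rstruct.
From Stdlib Require Znat.
From Stdlib Require Import Reals Lra.

Lemma exp_le (x y : R) : (x <= y -> exp x <= exp y)%R.
Proof. by case=> [/exp_increasing/Rlt_le|->] //; right. Qed.

Lemma ln_le (x y : R) : (0 < x -> x <= y -> ln x <= ln y)%R.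
Proof. by move=> x0 [/(ln_increasing _ _ x0)/Rlt_le|->] //; right. Qed.

Lemma exp_pow (x : R) (m : nat) : (exp x ^ m = exp (INR m * x))%R.
Proof.
elim: m => [|m IHm]; first by rewrite /= Rmult_0_l exp_0.
by rewrite S_INR Rmult_plus_distr_r Rmult_1_l exp_plus -IHm /= Rmult_comm.
Qed.

Lemma maker_wins_rainbow_log (n b : nat) :
  (64 <= n)%N -> (8 ^ 16 <= INR n)%R -> (0 < b)%N ->
  (INR b <= ln 2 / 8 * (INR n ^ 2 / ln (INR n)))%R ->
  maker_wins (RS_board n) (@is_rainbow_spanning_tree n) b.
Proof.
move=> n64 nbig b0 leb.
have n1 : (1 < INR n)%R by apply: (lt_INR 1); lia.
have L0 : (0 < ln (INR n))%R by rewrite -ln_1; apply: ln_increasing; Lra.lra.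
have B0 : (0 < INR b)%R by apply: (lt_INR 0); lia.
have l2 : (0 < ln 2)%R by have := ln_lt_2; Lra.lra.
(* This is [2 ^ (1 / b)]; the assumed bound on [b] is then exactly [n ^ 8 <= lam ^ (n ^ 2)]. *)
pose lam := exp (ln 2 / INR b).
have lamb : (lam ^ b = 2)%R.
  rewrite /lam exp_pow; have -> : (INR b * (ln 2 / INR b) = ln 2)%R by field; Lra.lra.
  by rewrite exp_ln //; Lra.lra.
have lam1 : (1 <= lam)%R.
  have := exp_ineq1_le (ln 2 / INR b); rewrite -/lam.
  have := Rdiv_lt_0_compat _ _ l2 B0; Lra.lra.
have lamn : (INR n ^ 8 <= lam ^ expn n 2)%R.
  rewrite -{1}(exp_ln (INR n)); last by Lra.lra.
  rewrite /lam !exp_pow; apply: exp_le.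
  have -> : INR (expn n 2) = (INR n ^ 2)%R by rewrite -mulnn mult_INR /=; Lra.lra.
  have -> : (INR 8 = 8)%R by rewrite /=; Lra.lra.
  apply: (Rmult_le_reg_r (INR b)) => //.
  have -> : (INR n ^ 2 * (ln 2 / INR b) * INR b = INR n ^ 2 * ln 2)%R by field; Lra.lra.
  apply: Rle_trans (_ : 8 * ln (INR n) * (ln 2 / 8 * (INR n ^ 2 / ln (INR n))) <= _)%R.
    by apply: Rmult_le_compat_l => //; Lra.lra.
  by right; field; Lra.lra.
apply: (@maker_wins_rainbow R n b lam) => //.
- apply/RleP; rewrite -!INRE -RpowE; have -> : (INR 8 = 8)%R by rewrite /=; Lra.lra.
  exact: nbig.
- exact/RleP.
- apply/RleP; rewrite -!INRE -RpowE lamb.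
  by right.
by apply/RleP; rewrite -!INRE -!RpowE.
Qed.

(** The harmonic sum is at least [ln (m + 1)], and rounding down loses at most 1 in each of the [m]
    terms. *)
Lemma sum_divn_ge_ln (b m : nat) :
  (INR b * ln (INR m.+1) - INR m <= INR (\sum_(1 <= l < m.+1) b %/ l))%R.
Proof.
elim: m => [|m IHm]; first by rewrite big_nil /= ln_1; Lra.lra.
rewrite big_nat_recr //= plus_INR -/(INR m.+2) -/(INR m.+1).
have M0 : (0 < INR m.+1)%R by apply: (lt_INR 0); lia.
have B0 := pos_INR b.
have quot : (INR b / INR m.+1 - 1 <= INR (b %/ m.+1))%R.
  have : (INR b <= INR (m.+1 * (b %/ m.+1).+1))%R.
    by apply: le_INR; have := ltn_ceil b (ltn0Sn m); lia.
  rewrite mult_INR [INR (_ %/ _).+1]S_INR => leb.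
  apply: (Rmult_le_reg_r (INR m.+1)) => //.
  have -> : ((INR b / INR m.+1 - 1) * INR m.+1 = INR b - INR m.+1)%R by field; Lra.lra.
  by Lra.nra.
have lnS : (ln (INR m.+2) <= ln (INR m.+1) + / INR m.+1)%R.
  have -> : (INR m.+2 = INR m.+1 * (1 + / INR m.+1))%R.
    by rewrite [INR m.+2]S_INR; field; Lra.lra.
  have inv0 := Rinv_0_lt_compat _ M0.
  rewrite ln_mult //; last by Lra.lra.
  apply: Rplus_le_compat_l; rewrite -[X in (_ <= X)%R]ln_exp.
  apply: ln_le; first by Lra.lra.
  exact: exp_ineq1_le.
have := Rmult_le_compat_l _ _ _ B0 lnS; rewrite [INR m.+1 in X in (_ - X <= _)%R]S_INR.
move: quot; rewrite /Rdiv; Lra.lra.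
Qed.

Lemma breaker_wins_rainbow_log (n b : nat) : (64 <= n)%N ->
  (INR n ^ 2 / ln (INR n) - 1 <= INR b)%R ->
  breaker_wins (RS_board n) (@is_rainbow_spanning_tree n) b.
Proof.
move=> n64 leb; apply: breaker_wins_rainbow; first by lia.
apply/ssrnat.leP/INR_le; rewrite mult_INR.
have n64R : (64 <= INR n)%R.
  have -> : (64 = INR 64)%R by rewrite INR_IZR_INZ.
  by apply: le_INR; lia.
have -> : n.-1 = n.-2.+1 by lia.
have := sum_divn_ge_ln b n.-2; set S := \sum_(1 <= l < _) _.
have n2 : INR n = (INR n.-2 + 2)%R.
  have {1}-> : n = n.-2.+2 by lia.
  by rewrite !S_INR; Lra.lra.
have -> : INR n.-2.+1 = (INR n - 1)%R by rewrite S_INR n2; Lra.lra.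
have -> : INR n.-2 = (INR n - 2)%R by Lra.lra.
have -> : INR (2 * S) = (2 * INR S)%R by rewrite mult_INR.
move: (INR S) (INR b) leb n64R => s B; set x := INR n => leb x64.
have L0 : (0 < ln x)%R by rewrite -ln_1; apply: ln_increasing; Lra.lra.
have Lx : (ln x <= x)%R.
  by have := exp_ineq1_le (ln x); rewrite exp_ln; Lra.lra.
(* Any factor above [1 / 2] would do for large [x], since a box has only about [x ^ 2 / 2] elements;
   [2 ^ 4 <= x] yields [3 / 4]. *)
have ln1 : (3 / 4 * ln x <= ln (x - 1))%R.
  have le2 : (ln (x / 2) <= ln (x - 1))%R by apply: ln_le; Lra.lra.
  have : (ln (2 ^ 4) <= ln x)%R by apply: ln_le; Lra.lra.
  rewrite ln_pow; last by Lra.lra.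
  move: le2; rewrite /Rdiv ln_mult ?ln_Rinv; try Lra.lra.
  rewrite (_ : INR 4 = 4%R); last by rewrite /=; Lra.lra.
  by Lra.lra.
have X1 : (1 <= x ^ 2 / ln x)%R.
  apply: (Rmult_le_reg_r (ln x)) => //.
  have -> : (x ^ 2 / ln x * ln x = x ^ 2)%R by field; Lra.lra.
  by Lra.nra.
have B1 : ((x ^ 2 / ln x - 1) * (3 / 4 * ln x) <= B * ln (x - 1))%R.
  by apply: Rmult_le_compat => //; Lra.lra.
have := B1; have -> : ((x ^ 2 / ln x - 1) * (3 / 4 * ln x) = 3 / 4 * x ^ 2 - 3 / 4 * ln x)%R.
  by field; Lra.lra.
Lra.nra.
Qed.

(** * Asymptotics of the threshold bias *)

Lemma nat_floor (x : R) : (0 <= x)%R -> exists k : nat, (x - 1 <= INR k <= x)%R.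
Proof.
move=> x0; have [up1 up2] := archimed x.
have up0 : (0 < up x)%Z by apply: lt_IZR; Lra.lra.
exists (Z.to_nat (up x - 1)); rewrite INR_IZR_INZ Znat.Z2Nat.id; last by lia.
by rewrite minus_IZR; Lra.lra.
Qed.

Theorem theorem1p7 :
  forall eps : R, (0 < eps)%R ->
  exists N : nat, forall n : nat, (N <= n)%N ->
  exists b0 : nat,
    is_threshold_bias (RS_board n) (@is_rainbow_spanning_tree n) b0 /\
    ((ln 2 / 8 - eps) * (INR n ^ 2 / ln (INR n)) <= INR b0)%R /\
    (INR b0 <= (1 + eps) * (INR n ^ 2 / ln (INR n)))%R.
Proof.
move=> eps eps0; have [N0 N0big] := INR_unbounded (8 ^ 16).
exists (maxn 64 N0) => n; rewrite geq_max => /andP[n64 nN0].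
have nbig : (8 ^ 16 <= INR n)%R.
  by apply: Rle_trans (Rlt_le _ _ N0big) (le_INR _ _ _); apply/ssrnat.leP.
have n64R : (64 <= INR n)%R.
  have -> : (64 = INR 64)%R by rewrite INR_IZR_INZ.
  by apply: le_INR; lia.
have L0 : (0 < ln (INR n))%R by rewrite -ln_1; apply: ln_increasing; Lra.lra.
have Ln : (ln (INR n) <= INR n)%R.
  by have := exp_ineq1_le (ln (INR n)); rewrite exp_ln; Lra.lra.
set X := (INR n ^ 2 / ln (INR n))%R.
have X64 : (64 <= X)%R.
  apply: (Rmult_le_reg_r (ln (INR n))) => //.
  have -> : (X * ln (INR n) = INR n ^ 2)%R by rewrite /X; field; Lra.lra.
  by Lra.nra.
have [|b1 [b1X Xb1]] := @nat_floor X; first by Lra.lra.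
have [b0 thr b01] := threshold_bias_exists (breaker_wins_rainbow_log n64 b1X).
exists b0; split=> //; have l2 := ln_lt_2; split; last first.
  have : (INR b0 <= INR b1)%R by apply/le_INR/ssrnat.leP.
  by Lra.nra.
apply: Rnot_lt_le => ltb0.
(* Maker's criterion requires a positive bias, so it is applied at [maxn b0 1]; bias 1 is in range
   because [X] is at least 64. *)
have /thr : b0 <= maxn b0 1 by rewrite leq_maxl.
rewrite /breaker_wins maker_wins_rainbow_log ?leq_maxr //.
rewrite -/X; have [b00|b0gt] := posnP b0; first by rewrite b00 /=; Lra.nra.
rewrite (maxn_idPl b0gt); have := Rmult_lt_0_compat eps X eps0 ltac:(Lra.lra).
by Lra.lra.
Qed.
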